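(* For any integer $n \geq 0$ (with $a$ denoting a nonnegative integer), $$v_2(B_n(4,1)) = \begin{cases} 1+v_2(a), & \text{if } n=5a \text{ and } v_2(a) \leq 5, \\ 0, & \text{if } n \equiv 1 \pmod{5}, \\ 1+ v_2(a), & \text{if } n=5a + 2 \text{ and } v_2(a) \leq 4, \\ 1+ v_2 \big( a(a+1) \big), & \text{if } n=5a + 3 \text{ and } v_2 \big( a(a+1) \big) \leq 5, \\ 0, & \text{if } n \equiv 4 \pmod{5}. \end{cases}$$ (No assertion is made for values of $n$ not covered by these cases.)
   Context: The sequence $\{B_n(4,1)\}_{n\geq 0}$ is defined by $B_n = B_{n-1}+B_{n-2}+B_{n-3}+B_{n-4}$ for $n \geq 4$, with $(B_0,B_1,B_2,B_3)=(0,1,0,0)$. $v_2$ denotes the 2-adic order (2-adic valuation), with the convention $v_2(0)=+\infty$. *)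

(* Defs.v *)
From mathcomp Require Import all_boot all_order all_algebra.
From mathcomp Require Import constructive_ereal.

Set Implicit Arguments.
Unset Strict Implicit.
Unset Printing Implicit Defensive.

(* B n is B_n(4,1); the last branch is the case m + 4. *)
Fixpoint B (n : nat) : nat :=
  match n with
  | 0 => 0
  | 1 => 1
  | 2 => 0
  | 3 => 0
  | S ((S ((S ((S m) as m1)) as m2)) as m3) => B m3 + B m2 + B m1 + B m
  end.

(* Extended-valued because logn 2 0 = 0, whereas v_2(0) = +oo. *)
Definition v2 (n : nat) : \bar int :=
  if n == 0 then +oo%E else ((logn 2 n)%:Z%R)%:E.

(* Main.v *)
Require Import Defs.
From mathcomp Require Import all_boot all_order all_algebra.
From mathcomp Require Import constructive_ereal.

(** Modulo 2 ^ 7 the sequence B has period 320, and [v2 x = k] only depends on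
    x modulo 2 ^ k.+1. Since all the valuations asserted are at most 6, every
    case reduces to a computation over one period, i.e. over a modulo 64. *)

(** A window of four consecutive terms, kept below 128 so that the tables stay computable on unary
    [nat]. *)
Definition step (s : nat * nat * nat * nat) :=
  let: (x, y, z, t) := s in (y, z, t, (t + z + y + x) %% 128).

Definition residues n := iter n step (0, 1, 0, 0).

Definition Bmod n := (residues n).1.1.1.

Lemma B_rec n : B n.+4 = B n.+3 + B n.+2 + B n.+1 + B n.
Proof. by []. Qed.

Lemma residuesE n :
  residues n = (B n %% 128, B n.+1 %% 128, B n.+2 %% 128, B n.+3 %% 128).
Proof.
have modD4 x y z t d :
  (x %% d + y %% d + z %% d + t %% d) %% d = (x + y + z + t) %% d.
  by rewrite -[RHS]modnDm -(modnDm (x + y)) -(modnDm x) [RHS]modnDml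
    -[in RHS]addnA [RHS]modnDml addnA.
elim: n => // n IHn.
by rewrite /residues iterS -/(residues n) IHn /step B_rec modD4.
Qed.

Lemma BmodE n : Bmod n = B n %% 128.
Proof. by rewrite /Bmod residuesE. Qed.

(** Running 320 steps from the initial window returns that same window, by computation. *)
Lemma residues_period n : residues (n + 320) = residues n.
Proof. by rewrite /residues iterD; congr iter. Qed.

Lemma Bmod_modn n : Bmod (n %% 320) = Bmod n.
Proof.
rewrite [in RHS](divn_eq n 320) /Bmod; congr (_.1.1.1).
move: (n %% 320) => m; elim: (n %/ 320) => // q IHq.
by rewrite mulSnr addnAC residues_period.
Qed.

Lemma B_mod_pow2 n k : k <= 7 -> B n %% 2 ^ k = Bmod (n %% 320) %% 2 ^ k.
Proof.
by move=> k7; rewrite Bmod_modn BmodE modn_dvdm // (@dvdn_exp2l 2 k 7).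
Qed.

(** The odd cofactor of 2 ^ k in x is 1 modulo 2. For x = 0 both sides fail, the order being +oo and
    the residue 0. *)
Lemma v2E x k : v2 x = (k%:Z%R)%:E%E <-> x %% 2 ^ k.+1 = 2 ^ k.
Proof.
rewrite /v2; case: (posnP x) => [->|x_gt0].
  split=> [//|]; rewrite mod0n => /esym/eqP.
  by rewrite expn_eq0.
split=> [[<-]|x_mod].
  have [m m_odd {1}->] := pfactor_coprime (isT : prime 2) x_gt0.
  rewrite expnS -muln_modl modn2.
  by rewrite coprime2n in m_odd; rewrite m_odd mul1n.
(* With q the quotient, x = (2q + 1) * 2 ^ k. *)
rewrite (divn_eq x (2 ^ k.+1)) x_mod expnS mulnA -mulSnr.
rewrite lognM ?expn_gt0 // pfactorK // lognE /= dvdn2 oddS oddM andbF.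
by rewrite add0n.
Qed.

(** Through [v2E], each entry says that order k for [f a] forces order k + 1 for the term of index
    5a + r. *)
Definition v2_table (f : nat -> nat) (r K : nat) :=
  all (fun a => all (fun k =>
      (f a %% 2 ^ k.+1 == 2 ^ k) ==> (Bmod (5 * a + r) %% 2 ^ k.+2 == 2 ^ k.+1))
    (iota 0 K.+1)) (iota 0 64).

(** The bound 5 on K keeps the modulus 2 ^ (k + 2) within 2 ^ 7. *)
Lemma v2_B_of_table (f : nat -> nat) (r K a : nat) :
    r < 5 -> K <= 5 -> f a = f (a %% 64) %[mod 64] -> v2_table f r K ->
    (v2 (f a) <= (K%:Z%R)%:E)%E ->
  v2 (B (5 * a + r)) = (1 + v2 (f a))%E.
Proof.
move=> r5 K5 f_per tab v2K.
(* The finite bound excludes [f a = 0], whose order is +oo. *)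
have [k v2k] : exists k : nat, v2 (f a) = (k%:Z%R)%:E%E.
  by move: v2K; rewrite /v2; case: eqP => // _ _; eexists.
move: v2K; rewrite v2k lee_fin lez_nat => kK.
have k5 := leq_trans kK K5.
suff -> : v2 (B (5 * a + r)) = (k.+1%:Z%R)%:E%E by rewrite intS EFinD.
apply/v2E; rewrite B_mod_pow2 //.
(* Since 320 = 5 * 64 and r < 5, reducing the index amounts to reducing a modulo 64. *)
have -> : (5 * a + r) %% 320 = 5 * (a %% 64) + r.
  rewrite {1}(divn_eq a 64) mulnDr -addnA mulnCA modnMDl modn_small //.
  have := ltn_pmod a (isT : 0 < 64); rewrite -ltnS => a64.
  rewrite (@leq_trans (5 * (a %% 64).+1)) ?mulnSr ?ltn_add2l //.
  by rewrite -mulnSr (leq_mul2l 5 _ 64).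
have /allP/(_ (a %% 64)) := tab; rewrite mem_iota ltn_pmod // => /(_ isT).
move=> /allP/(_ k); rewrite mem_iota ltnS kK => /(_ isT)/implyP tabk.
apply/eqP/tabk/eqP; rewrite -(iffLR (v2E _ _) v2k).
(* As k <= 5, the residue of [f a] modulo 2 ^ (k + 1) is determined by a modulo 64. *)
have dvd64 : 2 ^ k.+1 %| 64 by rewrite (@dvdn_exp2l 2 _ 6).
by rewrite -(modn_dvdm (f a) dvd64) f_per modn_dvdm.
Qed.

Lemma v2_B_odd r n : n = r %[mod 5] ->
  all (fun a => Bmod (5 * a + r %% 5) %% 2 == 1) (iota 0 64) -> v2 (B n) = 0%E.
Proof.
move=> n_r /allP odd_tab; apply/(v2E _ 0); rewrite B_mod_pow2 //.
(* As 5 divides 320, the reduced index is 5q + r %% 5 with q < 64, an entry of the table. *)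
rewrite (divn_eq (n %% 320) 5) mulnC modn_dvdm // n_r.
by apply/eqP/odd_tab; rewrite mem_iota ltn_divLR // ltn_pmod.
Qed.

Lemma v2_table0 : v2_table id 0 5. Proof. by vm_compute. Qed.

Lemma v2_table2 : v2_table id 2 4. Proof. by vm_compute. Qed.

Lemma v2_table3 : v2_table (fun a => a * (a + 1)) 3 5.
Proof. by vm_compute. Qed.

Theorem theorem14 (n : nat) :
  [/\ forall a : nat, n = 5 * a -> (v2 a <= 5%:E)%E ->
        v2 (B n) = (1 + v2 a)%E,
      n = 1 %[mod 5] -> v2 (B n) = 0%E,
      forall a : nat, n = 5 * a + 2 -> (v2 a <= 4%:E)%E ->
        v2 (B n) = (1 + v2 a)%E,
      forall a : nat, n = 5 * a + 3 -> (v2 (a * (a + 1)) <= 5%:E)%E ->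
        v2 (B n) = (1 + v2 (a * (a + 1)))%E
    & n = 4 %[mod 5] -> v2 (B n) = 0%E].
Proof.
have id_mod a : a = a %% 64 %[mod 64] by rewrite modn_mod.
split=> [a -> v2a|n1|a -> v2a|a -> v2a|n4].
- rewrite -[5 * a]addn0.
  exact: (v2_B_of_table id 0 5 a isT isT (id_mod a) v2_table0 v2a).
- apply: (v2_B_odd 1) n1 _. by vm_compute.
- exact: (v2_B_of_table id 2 4 a isT isT (id_mod a) v2_table2 v2a).
- apply: (v2_B_of_table (fun a => a * (a + 1)) 3 5 a isT isT _ v2_table3 v2a).
  by rewrite -[RHS]modnMm modn_mod modnDml modnMm.
- apply: (v2_B_odd 4) n4 _. by vm_compute.
Qed.
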